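(* Let $(l,m)$ and $(l',m')$ be systems of axes, with origins $O = l \cap m$ and $O' = l' \cap m'$. Consider the map from the set of points on $l \cup m$ to the set of points on $l' \cup m'$ that sends each point of $l$ to the point of $l'$ with the same coordinate in $T$, and each point of $m$ to the point of $m'$ with the same coordinate in $T$. Then this map extends uniquely to a rigid motion of the plane.
   Context: Setting. A plane consists of a set of points, a family of lines (sets of points), a (strict) betweenness relation, and a relation $\cong$ (congruence) on segments, with the following assumptions. Incidence: two distinct points lie on exactly one line; every line has at least two points; there exist three non-collinear points. Order: the points of each line carry a pair of mutually opposite total orders, and $C$ lies between $A$ and $B$ iff it lies strictly between them on their common line for these orders. For $A \ne B$, the segment $AB = BA$ consists of $A$, $B$ and all points between them; between any two distinct points there is another point; every segment can be extended beyond either end. A point $O$ of a line divides the line into two opposite rays based at $O$ having only $O$ in common; $\overrightarrow{OA}$ denotes the ray based at $O$ containing $A\neq O$. Plane separation: each line $l$ partitions the points not on $l$ into two nonempty classes (the sides of $l$); each side is convex (contains the segment $AB$ whenever it contains $A$ and $B$), and a segment with ends on different sides of $l$ meets $l$. Congruence: $\cong$ is an equivalence relation on (undirected) segments. For every segment $AB$ and every ray based at a point $O$ there is a unique point $X \neq O$ on that ray with $OX \cong AB$. Addition and subtraction of segments: let $B$ lie between $A$ and $C$, and $B'$ between $A'$ and $C'$. If two of $AB \cong A'B'$, $BC \cong B'C'$, $AC \cong A'C'$ hold, so does the third. Every segment $BC$ has a midpoint (a point $M$ between $B$ and $C$ with $MB\cong MC$). Axiom T: if $A,B,C$ are non-collinear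 points and $A'B' \cong AB$, where $A'$ and $B'$ lie on a line $l$, then on either side of $l$ there is a point $C'$ with $A'C' \cong AC$ and $B'C' \cong BC$. Angles: an angle is a pair of rays, not lying on a common line, with the same base point (its vertex); $\angle XMY$ has rays $\overrightarrow{MX}$, $\overrightarrow{MY}$. If $A,B,C$ are non-collinear with $AB \cong AC$ and $M$ is the midpoint of $BC$, then $\angle AMB$ and $\angle AMC$ are called paired right angles at $M$. A right angle is an angle that is a member of some such pair. Axiom R1: if $\angle BAC$ and $\angle EDF$ are right angles with $AB \cong DE$ and $AC \cong DF$, then $BC \cong EF$. Axiom R2: at most one angle of a triangle (three non-collinear points) is a right angle. Perpendiculars: two distinct lines meeting at $M$ are perpendicular if any two consecutive ones of the four angles they form at $M$ are paired right angles. It is assumed that perpendiculars can be dropped to any line from a point not on it and erected at any point on a line. The group $T$ and coordinates: an ordered line is a line with a choice of one of its two total orders. Fix a reference ordered line; $T$ is the ordered abelian group of its translations, i.e. its order-preserving bijections $f$ with $f(X)f(Y)\cong XY$ for all distinct $X,Y$ (it acts regularly on the points; $f>0$ iff $f(X)>X$ for all $X$). Each segment $AB$ has a magnitude, the positive $f\in T$ with $Xf(X)\cong AB$ for every point $X$ of the reference line; segments are congruent iff their magnitudes are equal. Given an ordered line and a point $O$ on it, the coordinate of a point $P$ of that line is $0$ if $P=O$, the magnitude of $OP$ if $P>O$, and minus that magnitude if $P<O$; this is an order-preserving bijection of the line with $T$. A system of axes is an ordered pair $(l,m)$ of perpendicular ordered lines, each coordinatized by $T$ with $0$ at their intersection point.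 A rigid motion of the plane is a permutation $X\mapsto X'$ of the points that preserves congruences of segments, meaning $X'Y'\cong XY$ for all distinct points $X,Y$. *)

(* Defs.v *)
From mathcomp Require Export all_boot boolp classical_sets.

Set Implicit Arguments.
Unset Strict Implicit.
Unset Printing Implicit Defensive.

Local Open Scope classical_set_scope.

(* [bet A C B]: C lies strictly between A and B.
   [cong A B C D]: the segments AB and CD are congruent. *)
Record geometry := Geometry {
  point :> Type;
  line : set (set point);
  bet : point -> point -> point -> Prop;
  cong : point -> point -> point -> point -> Prop
}.
Arguments line {g}.
Arguments bet {g}.
Arguments cong {g}.

Section Notions.
Variable G : geometry.
Implicit Types (A B C M O P X Y : G) (l m S : set G).

Definition collinear A B C := exists l, [/\ line l, l A, l B & l C].

(* [lt] matters only on l. The two mutually opposite orders carried by a line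
   are the strict total orders which induce the betweenness on that line. *)
Record line_order l (lt : G -> G -> Prop) : Prop := LineOrder {
  line_order_irr : forall A, l A -> ~ lt A A;
  line_order_trans : forall A B C, l A -> l B -> l C ->
    lt A B -> lt B C -> lt A C;
  line_order_total : forall A B, l A -> l B -> A <> B -> lt A B \/ lt B A;
  line_order_bet : forall A B C, l A -> l B -> l C ->
    (bet A C B <-> (lt A C /\ lt C B) \/ (lt B C /\ lt C A))
}.

(* Meaningful for A <> B. *)
Definition segment A B : set G := [set X | X = A \/ X = B \/ bet A X B].

Definition convex S := forall A B, S A -> S B -> A <> B -> segment A B `<=` S.

Definition sides l S1 S2 :=
  [/\ S1 !=set0, S2 !=set0, S1 `&` S2 = set0 & S1 `|` S2 = ~` l] /\
  [/\ convex S1, convex S2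
    & forall A B, S1 A -> S2 B -> segment A B `&` l !=set0].

Definition side l S := exists S', sides l S S'.

(* The ray based at O containing A, for A <> O. *)
Definition ray O A : set G :=
  [set X | exists l, [/\ line l, l O, l A & l X] /\ ~ bet X O A].

Definition midpoint M B C := bet B M C /\ cong M B M C.

(* The angle with vertex M, as an unordered pair of rays; it is a genuine angle
   only when X, M, Y are not collinear. *)
Definition angle X M Y : set (set G) := [set ray M X; ray M Y].

Definition paired_right_angles M (a b : set (set G)) :=
  exists A B C, [/\ ~ collinear A B C, cong A B A C, midpoint M B C,
    a = angle A M B & b = angle A M C].

Definition right_angle (a : set (set G)) :=
  exists M b, paired_right_angles M a b.

(* Two of the four angles formed by l and m at M are consecutive when they
   share one ray and their other rays are opposite. *)
Definition perpendicular l m :=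
  l <> m /\ exists M, [/\ l M, m M &
    forall X X' Y Y', l X -> l X' -> m Y -> m Y' -> bet X M X' -> bet Y M Y' ->
      paired_right_angles M (angle X M Y) (angle X M Y') /\
      paired_right_angles M (angle Y M X) (angle Y M X')].

Record plane_axioms : Prop := PlaneAxioms {
  line_unique : forall A B, A <> B -> exists! l, [/\ line l, l A & l B];
  line_two_points : forall l, line l -> exists A B, [/\ A <> B, l A & l B];
  three_points : exists A B C, ~ collinear A B C;

  bet_collinear : forall A B C, bet A C B -> collinear A C B;
  line_ordered : forall l, line l -> exists lt, line_order l lt;
  bet_dense : forall A B, A <> B -> exists C, bet A C B;
  bet_extend : forall A B, A <> B -> exists C, bet A B C;

  plane_separation : forall l, line l -> exists S1 S2, sides l S1 S2;

  (* only segments, whose ends are distinct, are compared *)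
  cong_segment : forall A B C D, cong A B C D -> A <> B /\ C <> D;
  cong_swap : forall A B, A <> B -> cong A B B A;
  cong_refl : forall A B, A <> B -> cong A B A B;
  cong_sym : forall A B C D, cong A B C D -> cong C D A B;
  cong_trans : forall A B C D E F, cong A B C D -> cong C D E F -> cong A B E F;
  cong_transfer : forall A B O P, A <> B -> O <> P ->
    exists! X, [/\ X <> O, ray O P X & cong O X A B];
  cong_addition : forall A B C A' B' C', bet A B C -> bet A' B' C' ->
    [/\ cong A B A' B' -> cong B C B' C' -> cong A C A' C',
        cong A B A' B' -> cong A C A' C' -> cong B C B' C'
      & cong B C B' C' -> cong A C A' C' -> cong A B A' B'];
  midpoint_exists : forall B C, B <> C -> exists M, midpoint M B C;

  axiom_T : forall A B C A' B' l S, ~ collinear A B C -> cong A' B' A B ->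
    line l -> l A' -> l B' -> side l S ->
    exists C', [/\ S C', cong A' C' A C & cong B' C' B C];
  axiom_R1 : forall A B C D E F,
    right_angle (angle B A C) -> right_angle (angle E D F) ->
    cong A B D E -> cong A C D F -> cong B C E F;
  axiom_R2 : forall A B C, ~ collinear A B C ->
    ~ (right_angle (angle B A C) /\ right_angle (angle A B C));

  perpendicular_drop : forall l P, line l -> ~ l P ->
    exists m, [/\ line m, m P & perpendicular l m];
  perpendicular_erect : forall l P, line l -> l P ->
    exists m, [/\ line m, m P & perpendicular l m]
}.

End Notions.

Record plane := Plane {
  plane_geometry :> geometry;
  planeP : plane_axioms plane_geometry
}.

Record ordered_line (G : geometry) := OrderedLine {
  oline :> set G;
  olt : G -> G -> Prop;
  oline_line : line oline;
  oline_order : line_order oline olt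
}.

(* The elements of the group T, for the reference ordered line r. The group law
   is composition, so 0 is the identity and -f is the inverse bijection. *)
Record translation (G : geometry) (r : ordered_line G) := Translation {
  tr_fun :> r -> r;
  tr_bij : bijective tr_fun;
  tr_lt : forall X Y : r, olt r (val X) (val Y) ->
    olt r (val (tr_fun X)) (val (tr_fun Y));
  tr_cong : forall X Y : r, X <> Y ->
    cong (val (tr_fun X)) (val (tr_fun Y)) (val X) (val Y)
}.

Section Coordinates.
Variables (G : plane) (r : ordered_line G).

Lemma tr_zero_bij : bijective (fun X : r => X).
Proof. by exists id. Qed.

Definition tr_zero : translation r :=
  @Translation G r (fun X => X) tr_zero_bij (fun X Y h => h)
    (fun X Y h => cong_refl (planeP G) (fun e => h (val_inj e))).

Lemma tr_inv (f : translation r) :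
  {g : r -> r | cancel f g & cancel g f}.
Proof. by apply: cid2; have [g] := tr_bij f; exists g. Qed.

Lemma tr_inv_bij (f : translation r) : bijective (s2val (tr_inv f)).
Proof. by case: tr_inv => g fK gK /=; exists f. Qed.

Lemma tr_inv_lt (f : translation r) (X Y : r) : olt r (val X) (val Y) ->
  olt r (val (s2val (tr_inv f) X)) (val (s2val (tr_inv f) Y)).
Proof.
case: tr_inv => g fK gK /= ltXY.
have rP (Z : r) : oline r (val Z) by apply: set_mem (valP Z).
have [irr tra tot _] := oline_order r.
have [eg|ng] := pselect (val (g X) = val (g Y)).
  have eXY : X = Y by rewrite -[LHS]gK (val_inj eg) gK.
  by rewrite eXY in ltXY; case: (irr _ (rP Y)).
have [//|/(tr_lt f)] := tot _ _ (rP _) (rP _) ng.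
rewrite !gK => ltYX; case: (irr _ (rP X)).
exact: tra (rP X) (rP Y) (rP X) ltXY ltYX.
Qed.

Lemma tr_inv_cong (f : translation r) (X Y : r) : X <> Y ->
  cong (val (s2val (tr_inv f) X)) (val (s2val (tr_inv f) Y)) (val X) (val Y).
Proof.
case: tr_inv => g fK gK /= nXY; apply: (cong_sym (planeP G)).
rewrite -{1}(gK X) -{1}(gK Y); apply: tr_cong => eg.
by apply: nXY; rewrite -[LHS]gK eg gK.
Qed.

Definition tr_opp (f : translation r) : translation r :=
  Translation (tr_inv_bij f) (@tr_inv_lt f) (@tr_inv_cong f).

Definition tr_pos (f : translation r) :=
  forall X : r, olt r (val X) (val (f X)).

Definition is_magnitude (f : translation r) (A B : G) :=
  tr_pos f /\ forall X : r, cong (val X) (val (f X)) A B.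

Definition is_coordinate (l : ordered_line G) (O P : G) (t : translation r) :=
  [\/ P = O /\ t = tr_zero,
      olt l O P /\ is_magnitude t O P
    | olt l P O /\ exists f, is_magnitude f O P /\ t = tr_opp f].

Definition same_coordinate (l : ordered_line G) (O P : G)
    (l' : ordered_line G) (O' P' : G) :=
  exists t, is_coordinate l O P t /\ is_coordinate l' O' P' t.

End Coordinates.

Record axes (G : geometry) := Axes {
  xaxis : ordered_line G;
  yaxis : ordered_line G;
  origin : G;
  axes_perpendicular : perpendicular xaxis yaxis;
  origin_xaxis : oline xaxis origin;
  origin_yaxis : oline yaxis origin
}.

(* phi extends the map from the points of the axes a to the points of the axes
   a' which preserves the axis and the coordinate in T. *)
Definition extends_axes_map (G : plane) (r : ordered_line G) (a a' : axes G)
    (phi : G -> G) :=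
  (forall P, oline (xaxis a) P -> oline (xaxis a') (phi P) /\
     same_coordinate r (xaxis a) (origin a) P (xaxis a') (origin a') (phi P)) /\
  (forall P, oline (yaxis a) P -> oline (yaxis a') (phi P) /\
     same_coordinate r (yaxis a) (origin a) P (yaxis a') (origin a') (phi P)).

Definition rigid_motion (G : geometry) (phi : G -> G) :=
  bijective phi /\ forall X Y, X <> Y -> cong (phi X) (phi Y) X Y.

(* Main.v *)
Require Import Defs.

(** The motion is built over the first axis. Sending each point of the x-axis l
to the point of l' with the same coordinate is an isometry f of lines
([position_iso]). A point P off l is sent to the point P' on the corresponding
side of l' whose distances from the points f X are the distances of P from the
points X of l.

Such a P' exists ([iso_place]): reflecting a point of l in the foot of the
perpendicular from P gives an isosceles triangle with apex P and base on l, which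
Axiom T copies over l', and Axiom R1 then yields the other distances. It is
unique ([side_uniq]), because the points equidistant from two distinct points
are collinear ([equidistant_collinear]) and the midpoint of two points on one
side of l' is off l'. Together these facts replace the side-angle-side criterion:
a point off a line has its distances from all points of the line determined by
two of them ([iso_cong_off]).

The difficulty lies in [equidistant_collinear], that is, in the uniqueness of the
perpendicular erected at a point of a line ([perp_erect_uniq]). Right angles are
the only angles that can be compared, so it has to be extracted from Axioms R1
and R2 by means of midpoints and of the separation of the plane by a line.

The map P |-> P' preserves congruence. If the line PQ meets l, it is mapped
isometrically onto a line, by the determination of distances applied with PQ in
the role of the line ([matched_transversal]). If it does not, Q is replaced by a
point on the other side of l ([matched_isometry]).

On the y-axis, Axiom R1 shows that the point of m' with the same coordinate as P
has the required distances, so that it is P'. Two maps that preserve congruence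
and agree at three points with non-collinear images are equal
([preserves_cong_eq]): at a point where they differed, the three images would
be equidistant from the two values. This gives the uniqueness of the motion, and
also its bijectivity, since the maps built in the two directions compose to maps
which fix the axes pointwise. *)

Set Implicit Arguments.
Unset Strict Implicit.
Unset Printing Implicit Defensive.

Local Open Scope classical_set_scope.

Section AbsoluteGeometry.
Variable G : plane.
Implicit Types (A B C D E F M N O P Q R U V W X Y Z : G) (l m k n S : set G).

Let ax : plane_axioms G := planeP G.

(** * Lines, betweenness and rays *)

Lemma line_through A B : A <> B -> exists l, [/\ line l, l A & l B].
Proof. by move=> /(line_unique ax)[l [lAB _]]; exists l. Qed.

Lemma line_eq l m A B : line l -> line m -> A <> B ->
  l A -> l B -> m A -> m B -> l = m.
Proof.
move=> Ll Lm /(line_unique ax)[n [_ n_uniq]] lA lB mA mB.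
by rewrite -(n_uniq l) // -(n_uniq m).
Qed.

Lemma line_meet l m A B : line l -> line m -> l <> m ->
  l A -> m A -> l B -> m B -> A = B.
Proof.
move=> Ll Lm lm lA mA lB mB; apply: contrapT => nAB.
by apply: lm; apply: line_eq nAB _ _ _ _.
Qed.

Lemma line_other l A : line l -> exists B, B <> A /\ l B.
Proof.
move=> /(line_two_points ax)[B [C [nBC lB lC]]].
have [eBA|nBA] := pselect (B = A); last by exists B.
by exists C; split=> // eCA; apply: nBC; rewrite eBA eCA.
Qed.

Lemma collinearE l A B C : line l -> A <> B -> l A -> l B ->
  collinear A B C <-> l C.
Proof.
move=> Ll nAB lA lB; split=> [[m [Lm mA mB mC]]|lC]; last by exists l.
by rewrite (line_eq Ll Lm nAB lA lB mA mB).
Qed.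

Lemma lt_asym l lt A B : line_order l lt -> l A -> l B ->
  lt A B -> lt B A -> False.
Proof.
move=> lo lA lB AB BA; apply: (line_order_irr lo lA).
exact: (line_order_trans lo lA lB lA AB BA).
Qed.

Lemma betE l lt A B C : line_order l lt -> l A -> l B -> l C ->
  bet A C B = (lt A C /\ lt C B \/ lt B C /\ lt C A).
Proof. by move=> lo lA lB lC; apply/propext/(line_order_bet lo). Qed.

Lemma bet_line A B C : bet A B C ->
  exists l lt, [/\ line l, line_order l lt & [/\ l A, l B & l C]].
Proof.
move=> /(bet_collinear ax)[l [Ll lA lB lC]].
by have [lt lo] := line_ordered ax Ll; exists l, lt.
Qed.

Lemma bet_sym A B C : bet A B C -> bet C B A.
Proof.
move=> b; have [l [lt [_ lo [lA lB lC]]]] := bet_line b.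
move: b; rewrite (betE lo lA lC lB) (betE lo lC lA lB).
by case; [right|left].
Qed.

(** Closes a goal when the context holds a cycle of at most four strict
inequalities along the order lo. *)
Ltac lt_absurd lo := exfalso; match goal with
  | H1 : ?r ?A ?B, H2 : ?r ?B ?A |- _ =>
      by apply: (lt_asym lo _ _ H1 H2)
  | H1 : ?r ?A ?A |- _ => by apply: (line_order_irr lo _ H1)
  | H1 : ?r ?A ?B, H2 : ?r ?B ?C, H3 : ?r ?C ?A |- _ =>
      by apply: (lt_asym lo _ _ (line_order_trans lo _ _ _ H1 H2) H3)
  | H1 : ?r ?A ?B, H2 : ?r ?B ?C, H3 : ?r ?C ?D, H4 : ?r ?D ?A |- _ =>
      by apply: (lt_asym lo _ _ (line_order_trans lo _ _ _ H1 H2)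
        (line_order_trans lo _ _ _ H3 H4))
  end.

Lemma bet_neq A B C : bet A B C -> [/\ A <> B, B <> C & A <> C].
Proof.
move=> b; have [l [lt [_ lo [lA lB lC]]]] := bet_line b.
move: b; rewrite (betE lo lA lC lB) => b.
by split=> e; subst; case: b => -[h1 h2]; lt_absurd lo.
Qed.

Lemma bet_excl A B C : bet A B C -> ~ bet B A C.
Proof.
move=> b; have [l [lt [_ lo [lA lB lC]]]] := bet_line b.
move: b; rewrite (betE lo lA lC lB) (betE lo lB lC lA).
by case=> -[h1 h2] [] [h3 h4]; lt_absurd lo.
Qed.

Lemma bet_excl2 A B C : bet A B C -> ~ bet A C B.
Proof. by move=> b /bet_sym b2; apply: (bet_excl (bet_sym b)). Qed.

Lemma bet_total l A B C : line l -> l A -> l B -> l C ->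
  A <> B -> B <> C -> A <> C -> [\/ bet A B C, bet B A C | bet A C B].
Proof.
move=> Ll lA lB lC nAB nBC nAC; have [lt lo] := line_ordered ax Ll.
rewrite !(betE lo) //.
have [] := line_order_total lo lA lB nAB;
have [] := line_order_total lo lB lC nBC;
have [] := line_order_total lo lA lC nAC => *;
first [apply: Or31; tauto | apply: Or32; tauto | apply: Or33; tauto].
Qed.

Lemma bet_on1 l A B C : line l -> l B -> l C -> bet A B C -> l A.
Proof.
move=> Ll lB lC b; have [_ nBC _] := bet_neq b.
have [m [Lm mA mB mC]] := bet_collinear ax b.
by rewrite (line_eq Ll Lm nBC).
Qed.

Lemma bet_on2 l A B C : line l -> l A -> l C -> bet A B C -> l B.
Proof.
move=> Ll lA lC b; have [_ _ nAC] := bet_neq b.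
have [m [Lm mA mB mC]] := bet_collinear ax b.
by rewrite (line_eq Ll Lm nAC).
Qed.

Lemma bet_on3 l A B C : line l -> l A -> l B -> bet A B C -> l C.
Proof. by move=> Ll lA lB /bet_sym; apply: bet_on1. Qed.

Lemma not_bet_lt l lt O A B : line_order l lt -> l O -> l A -> l B ->
  A <> O -> B <> O -> ~ bet A O B ->
  (lt O A /\ lt O B) \/ (lt A O /\ lt B O).
Proof.
move=> lo lO lA lB nAO nBO; rewrite (betE lo) //.
have [] := line_order_total lo lA lO nAO;
have [] := line_order_total lo lB lO nBO; tauto.
Qed.

Lemma lt_not_bet l lt O A B : line_order l lt -> l O -> l A -> l B ->
  (lt O A /\ lt O B) \/ (lt A O /\ lt B O) -> ~ bet A O B.
Proof.
move=> lo lO lA lB h; rewrite (betE lo) // => -[] [h1 h2];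
by case: h => -[h3 h4]; lt_absurd lo.
Qed.

Lemma rayP l O A X : line l -> A <> O -> l O -> l A ->
  ray O A X <-> l X /\ ~ bet X O A.
Proof.
move=> Ll nAO lO lA; split=> [[m [[Lm mO mA mX] nb]]|[lX nb]]; last by exists l.
by split=> //; rewrite (line_eq Ll Lm nAO).
Qed.

Lemma ray_eq l O A B : line l -> l O -> l A -> l B -> A <> O -> B <> O ->
  ~ bet A O B -> ray O A = ray O B.
Proof.
move=> Ll lO lA lB nAO nBO nb; have [lt lo] := line_ordered ax Ll.
have AB := not_bet_lt lo lO lA lB nAO nBO nb.
have rA X := rayP X Ll nAO lO lA; have rB X := rayP X Ll nBO lO lB.
apply/seteqP; split=> X.
  move=> /rA[lX nbX]; apply/rB; split=> // b.
  have [nXO _ _] := bet_neq b.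
  have XA := not_bet_lt lo lO lX lA nXO nAO nbX.
  move: b; apply: (lt_not_bet lo) => //.
  by case: AB => -[a1 a2]; case: XA => -[b1 b2]; try tauto; lt_absurd lo.
move=> /rB[lX nbX]; apply/rA; split=> // b.
have [nXO _ _] := bet_neq b.
have XB := not_bet_lt lo lO lX lB nXO nBO nbX.
move: b; apply: (lt_not_bet lo) => //.
by case: AB => -[a1 a2]; case: XB => -[b1 b2]; try tauto; lt_absurd lo.
Qed.

Lemma cong_swapl A B C D : cong A B C D -> cong B A C D.
Proof.
move=> c; have [nAB _] := cong_segment ax c.
by apply: (cong_trans ax) c; apply: (cong_swap ax) => /esym.
Qed.

Lemma cong_swapr A B C D : cong A B C D -> cong A B D C.
Proof. by move=> /(cong_sym ax)/cong_swapl/(cong_sym ax). Qed.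

Lemma cong_swap2 A B C D : cong A B C D -> cong B A D C.
Proof. by move=> /cong_swapl/cong_swapr. Qed.

Lemma cong_ray_uniq l O X Y : line l -> l O -> l X -> l Y ->
  cong O X O Y -> ~ bet X O Y -> X = Y.
Proof.
move=> Ll lO lX lY c nb; have [nOX nOY] := cong_segment ax c.
have [W [_ uniq]] := cong_transfer ax nOY nOY.
have eWX : W = X.
  apply: uniq; split; [exact/nesym| |exact: c].
  exact/(rayP X Ll (nesym nOY) lO lY).
rewrite -eWX; apply: uniq; split; [exact/nesym| |exact: (cong_refl ax)].
by apply/(rayP Y Ll (nesym nOY) lO lY); split=> // /bet_neq[].
Qed.

Lemma ray_transfer l O P A B : line l -> l O -> l P -> P <> O -> A <> B ->
  exists X, [/\ l X, X <> O, ~ bet X O P & cong O X A B].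
Proof.
move=> Ll lO lP nPO nAB.
have [X [[nXO /(rayP _ Ll nPO lO lP)[lX nb] c] _]] :=
  cong_transfer ax nAB (nesym nPO).
by exists X.
Qed.

Lemma bet_ray l A O B X : line l -> l A -> l O -> l X -> X <> O ->
  bet A O B -> ~ bet X O B -> bet A O X.
Proof.
move=> Ll lA lO lX nXO b nb; have [nAO nOB _] := bet_neq b.
have lB := bet_on3 Ll lA lO b; have [lt lo] := line_ordered ax Ll.
have XB := not_bet_lt lo lO lX lB nXO (nesym nOB) nb.
move: b; rewrite !(betE lo) //.
by case=> -[h1 h2]; case: XB => -[h3 h4]; try tauto; lt_absurd lo.
Qed.

Lemma bet_opp l A O B X : line l -> l A -> l O -> l X -> X <> O ->
  bet A O B -> bet X O B -> ~ bet A O X.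
Proof.
move=> Ll lA lO lX nXO b b2; have lB := bet_on3 Ll lA lO b.
have [lt lo] := line_ordered ax Ll.
move: b b2; rewrite !(betE lo) //.
by case=> -[h1 h2] [] [h3 h4]; case=> -[h5 h6]; lt_absurd lo.
Qed.

Lemma extension A O C D : A <> O -> C <> D ->
  exists X, bet A O X /\ cong O X C D.
Proof.
move=> nAO nCD; have [B b] := bet_extend ax nAO.
have [l [lt [Ll lo [lA lO lB]]]] := bet_line b; have [_ nOB _] := bet_neq b.
have [X [lX nXO nb c]] := ray_transfer Ll lO lB (nesym nOB) nCD.
by exists X; split=> //; apply: bet_ray Ll lA lO lX nXO b nb.
Qed.

(** In the order A, M, N, B, suppose MA = MB and NA = NB, and prolong BM beyond M
by MN to V. Adding segments gives BV = AN = BN, so V = N, although M lies between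
B and V and N lies between B and M. *)
Lemma midpoint_inner A M N B : bet A M N -> bet M N B ->
  cong M A M B -> ~ cong N A N B.
Proof.
move=> b1 b2 cM cN; have [l [lt [Ll lo [lA lM lN]]]] := bet_line b1.
have lB := bet_on3 Ll lM lN b2.
have [_ nMB] := cong_segment ax cM; have [_ nMN _] := bet_neq b1.
have [V [bV cV]] := extension (nesym nMB) nMN.
have lV := bet_on3 Ll lB lM bV.
have [add _ _] := cong_addition ax bV b1.
have cBV : cong B V A N.
  by apply: add => //; apply: (cong_sym ax); apply: cong_swap2.
have cBVN : cong B V B N by apply: (cong_trans ax) cBV _; apply: cong_swap2.
have nb : ~ bet V B N.
  move: b2 bV; rewrite !(betE lo) //.
  by case=> -[h1 h2] [] [h3 h4] [] [h5 h6]; lt_absurd lo.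
have b3 := bet_sym b2.
have eVN := cong_ray_uniq Ll lB lV lN cBVN nb; rewrite eVN in bV.
exact: (bet_excl2 bV b3).
Qed.

Lemma midpoint_uniq l A B M N : line l -> l A -> l B -> l N ->
  midpoint M A B -> cong N A N B -> N = M.
Proof.
move=> Ll lA lB lN [bM cM] cN; have lM := bet_on2 Ll lA lB bM.
have [nAM nMB nAB] := bet_neq bM; have [nNA nNB] := cong_segment ax cN.
have bN : bet A N B.
  apply: contrapT => nb.
  by apply: nAB; apply: cong_ray_uniq Ll lN lA lB cN nb.
apply: contrapT => nNM.
have [lt lo] := line_ordered ax Ll.
have [b1|b1|b1] := bet_total Ll lA lM lN nAM (nesym nNM) (nesym nNA).
- apply: (midpoint_inner b1 _ cM cN).
  move: b1 bM bN; rewrite !(betE lo) //.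
  by case=> -[h1 h2] [] [h3 h4] [] [h5 h6]; try lt_absurd lo; tauto.
- move: b1 bM bN; rewrite !(betE lo) //.
  by case=> -[h1 h2] [] [h3 h4] [] [h5 h6]; lt_absurd lo.
apply: (midpoint_inner b1 _ cN cM).
move: b1 bM bN; rewrite !(betE lo) //.
by case=> -[h1 h2] [] [h3 h4] [] [h5 h6]; try lt_absurd lo; tauto.
Qed.

(** * Sides of a line *)

Lemma sides_sym l S1 S2 : sides l S1 S2 -> sides l S2 S1.
Proof.
case=> -[n1 n2 dis cov] [c1 c2 meet]; split; split=> //.
- by rewrite setIC.
- by rewrite setUC.
move=> A B sA sB; have [Z [sZ lZ]] := meet _ _ sB sA; exists Z; split=> //.
case: sZ => [->|[->|/bet_sym b]]; [right; left|left|right; right] => //.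
Qed.

Lemma sides_cover l S1 S2 P : sides l S1 S2 -> ~ l P -> S1 P \/ S2 P.
Proof. by case=> -[_ _ _ cov] _; rewrite -[~ _]/((~` l) P) -cov. Qed.

Lemma sides_off l S1 S2 P : sides l S1 S2 -> S1 P -> ~ l P.
Proof.
case=> -[_ _ _ cov] _ sP; rewrite -[~ _]/((~` l) P) -cov; by left.
Qed.

Lemma sides_disjoint l S1 S2 P : sides l S1 S2 -> S1 P -> ~ S2 P.
Proof.
by case=> -[_ _ dis _] _ s1 s2; have: (S1 `&` S2) P by []; rewrite dis.
Qed.

Lemma sides_same l S1 S2 A B Z :
  sides l S1 S2 -> S1 A -> S1 B -> bet A Z B -> ~ l Z.
Proof.
move=> sd sA sB b; have [_ _ nAB] := bet_neq b.
case: (sd) => _ [c1 _ _]; apply: (sides_off sd).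
by apply: (c1 A B) => //; right; right.
Qed.

Lemma sides_opposite l S1 S2 A B :
  sides l S1 S2 -> S1 A -> S2 B -> exists Z, l Z /\ bet A Z B.
Proof.
move=> sd sA sB; case: (sd) => _ [_ _ meet].
have [Z [sZ lZ]] := meet _ _ sA sB; exists Z; split=> //.
case: sZ => [eZ|[eZ|//]]; subst.
  by case: (sides_off sd sA).
by case: (sides_off (sides_sym sd) sB).
Qed.

Lemma side_of l P : line l -> ~ l P -> exists S1 S2, sides l S1 S2 /\ S1 P.
Proof.
move=> Ll nlP; have [S1 [S2 sd]] := plane_separation ax Ll.
have [sP|sP] := sides_cover sd nlP; first by exists S1, S2.
by exists S2, S1; split=> //; exact: sides_sym.
Qed.

(** * Right angles and perpendicular lines *)

Definition right X M Y := right_angle (angle X M Y).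

(** Perpendicularity with the foot made explicit and all right angles at it
recorded, so that the two lines play symmetric roles. *)
Record perp l m M : Prop := Perp {
  perp_linel : line l;
  perp_liner : line m;
  perp_neq : l <> m;
  perp_l : l M;
  perp_r : m M;
  perp_right : forall X Y, l X -> m Y -> X <> M -> Y <> M -> right X M Y
}.

Lemma right_sym X M Y : right X M Y -> right Y M X.
Proof. by rewrite /right /angle setUC. Qed.

Lemma perp_sym l m M : perp l m M -> perp m l M.
Proof.
case=> Ll Lm nlm lM mM r; split=> //; first exact/nesym.
by move=> X Y mX lY nX nY; apply/right_sym/r.
Qed.

Lemma perp_meet l m M X : perp l m M -> l X -> m X -> X = M.
Proof.
by case=> Ll Lm nlm lM mM r lX mX; apply: line_meet nlm _ _ _ _.
Qed.

Lemma right_ray l X M Y Z : line l -> l M -> l Y -> l Z -> Y <> M -> Z <> M ->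
  ~ bet Y M Z -> right X M Y -> right X M Z.
Proof.
move=> Ll lM lY lZ nY nZ nb; rewrite /right /angle.
by rewrite (ray_eq Ll lM lY lZ nY nZ nb).
Qed.

Lemma isosceles_right A B C M : ~ collinear A B C -> cong A B A C ->
  midpoint M B C -> right A M B.
Proof. by move=> nc c mid; exists M, (angle A M C), A, B, C. Qed.

Lemma midpoint_sym M B C : midpoint M B C -> midpoint M C B.
Proof. by case=> b c; split; [exact: bet_sym | exact: (cong_sym ax)]. Qed.

Lemma perpendicular_perp l m : line l -> line m -> perpendicular l m ->
  exists M, perp l m M.
Proof.
move=> Ll Lm [nlm [M [lM mM r]]]; exists M; split=> // X Y lX mY nX nY.
have [X' bX] := bet_extend ax nX; have [Y' bY] := bet_extend ax nY.
have [pr _] :=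
  r X X' Y Y' lX (bet_on3 Ll lX lM bX) mY (bet_on3 Lm mY mM bY) bX bY.
by exists M, (angle X M Y').
Qed.

Lemma perp_drop l P : line l -> ~ l P -> exists m M, perp l m M /\ m P.
Proof.
move=> Ll nlP; have [m [Lm mP p]] := perpendicular_drop ax Ll nlP.
by have [M pM] := perpendicular_perp Ll Lm p; exists m, M.
Qed.

Lemma perp_cong l m M l' m' M' X Y X' Y' :
  perp l m M -> perp l' m' M' -> l X -> m Y -> l' X' -> m' Y' ->
  cong M X M' X' -> cong M Y M' Y' -> cong X Y X' Y'.
Proof.
move=> p p' lX mY lX' mY' cX cY.
have [nX nX'] := cong_segment ax cX; have [nY nY'] := cong_segment ax cY.
apply: (axiom_R1 ax) cX cY.
  by apply: (perp_right p) => //; exact/nesym.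
by apply: (perp_right p') => //; exact/nesym.
Qed.

Lemma perp_foot_uniq l m m' M M' A : perp l m M -> perp l m' M' ->
  m A -> m' A -> ~ l A -> M = M'.
Proof.
move=> p p' mA mA' nlA; apply: contrapT => nM.
have [lM lM'] := (perp_l p, perp_l p').
apply: (@axiom_R2 _ ax M M' A).
  by rewrite (collinearE _ (perp_linel p) nM lM lM').
split; first by apply: (perp_right p) => // [/nesym//|eA]; rewrite eA in nlA.
by apply: (perp_right p') => // eA; rewrite eA in nlA.
Qed.

(** The foot of the perpendicular from the apex must be the midpoint of the
base, since otherwise apex, foot and midpoint would form a triangle with two
right angles. *)
Lemma isosceles_perp l A B C M : line l -> ~ l A -> l B -> l C ->
  cong A B A C -> midpoint M B C -> exists m, perp l m M /\ m A.
Proof.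
move=> Ll nlA lB lC c mid; have [nBM nMC nBC] := bet_neq mid.1.
have lM := bet_on2 Ll lB lC mid.1.
have nc : ~ collinear A B C.
  by move=> [n [Ln nA nB nC]]; apply: nlA; rewrite (line_eq Ll Ln nBC).
have nc' : ~ collinear A C B by move=> [n [? ? ? ?]]; apply: nc; exists n.
have rB := isosceles_right nc c mid.
have rC := isosceles_right nc' (cong_sym ax c) (midpoint_sym mid).
have [m [F [p mA]]] := perp_drop Ll nlA.
suff eF : F = M by exists m; rewrite -eF.
apply: contrapT => nFM; have lF := perp_l p.
have nAF : A <> F by move=> e; rewrite e in nlA.
apply: (@axiom_R2 _ ax F M A).
  by rewrite (collinearE _ Ll nFM lF lM).
split; first by apply: (perp_right p) => //; exact/nesym.
have [bFB|nbFB] := pselect (bet B M F); last first.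
  exact/right_sym/(right_ray Ll lM lB lF nBM nFM nbFB).
apply/right_sym/(right_ray Ll lM lC lF (nesym nMC) nFM) => // bFC.
by apply: (bet_opp Ll lB lM lF nFM mid.1 (bet_sym bFC)).
Qed.

(** Two unequal second legs would have ends on one ray, forming with the far end
of the first leg an isosceles triangle; its altitude and the first leg would be
two perpendiculars from the same point. *)
Lemma perp_hypotenuse l m M l' m' M' X Y X' Y' :
  perp l m M -> perp l' m' M' -> l X -> m Y -> l' X' -> m' Y' ->
  M <> Y -> M' <> Y' -> cong M X M' X' -> cong X Y X' Y' -> cong M Y M' Y'.
Proof.
move=> p p' lX mY lX' mY' nMY nMY' cX cXY.
have [Lm' mM'] := (perp_liner p', perp_r p').
have [W [mW nWM nb cW]] := ray_transfer Lm' mM' mY' (nesym nMY') nMY.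
have [eWY|nWY] := pselect (W = Y'); first by rewrite -eWY; apply: (cong_sym ax).
have cXW : cong X' W X' Y'.
  apply: (cong_trans ax) cXY; apply: (cong_sym ax).
  exact: perp_cong p p' lX mY lX' mW cX (cong_sym ax cW).
have [_ nMX'] := cong_segment ax cX.
have nmX' : ~ m' X' by move=> mX'; apply: nMX'; rewrite (perp_meet p' lX' mX').
have [N midN] := midpoint_exists ax nWY.
have [n [pn nX]] := isosceles_perp Lm' nmX' mW mY' cXW midN.
have eN := perp_foot_uniq pn (perp_sym p') nX lX' nmX'.
by case: nb; rewrite -eN; case: midN.
Qed.

(** Let P on m and Q on m' lie on opposite sides of k with NP = NQ. By Axiom R1
they are equidistant from each point of k. Let j be the line PQ, and M the
midpoint of PQ. If M is on k but not N, then j and k are perpendicular at M, and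
the triangle P M N has two right angles. If M = N, then m = j = m'. If M is off k,
let D and E be points of k symmetric in N: the perpendiculars to j from both have
foot M and the same length, so that every point of j is equidistant from D and E.
The point where j meets k is then N, and again m = j = m'. *)
Lemma perp_erect_uniq k m m' N : perp k m N -> perp k m' N -> m = m'.
Proof.
move=> p p'; have [Lk kN] := (perp_linel p, perp_l p).
have [Lm mN] := (perp_liner p, perp_r p).
have [Lm' mN'] := (perp_liner p', perp_r p').
have offk n X : perp k n N -> n X -> X <> N -> ~ k X.
  by move=> pn nX nXN kX; apply: nXN; apply: perp_meet pn _ _.
have [P [nPN mP]] := line_other N Lm.
have [S1 [S2 [sd S1P]]] := side_of Lk (offk _ _ p mP nPN).
have [Q [mQ nQN cQ S2Q]] :
    exists Q, [/\ m' Q, Q <> N, cong N Q N P & S2 Q].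
  have [Q0 [nQ0 mQ0]] := line_other N Lm'.
  have [Q [mQ nQN _ cQ]] := ray_transfer Lm' mN' mQ0 nQ0 (nesym nPN).
  have [S1Q|S2Q] := sides_cover sd (offk _ Q p' mQ nQN); last by exists Q.
  have [R [bR cR]] := extension nQN (nesym nPN).
  have mR := bet_on3 Lm' mQ mN' bR; have [_ nNR _] := bet_neq bR.
  exists R; split=> //; first exact/nesym.
  have [S1R|//] := sides_cover sd (offk _ R p' mR (nesym nNR)).
  by case: (sides_same sd S1Q S1R bR).
apply: contrapT => nmm'.
have [Z [kZ bZ]] := sides_opposite sd S1P S2Q.
have [nPZ nZQ nPQ] := bet_neq bZ.
have [j [Lj jP jQ]] := line_through nPQ; have jZ := bet_on2 Lj jP jQ bZ.
have njN : ~ j N.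
  move=> jN; apply: nmm'.
  by rewrite (line_eq Lm Lj nPN) // (line_eq Lm' Lj nQN).
have [M midM] := midpoint_exists ax nPQ.
have jM := bet_on2 Lj jP jQ midM.1.
have cNPQ := cong_sym ax cQ.
have kPQ D : k D -> D <> N -> cong D P D Q.
  move=> kD nD; apply: (perp_cong p p') cNPQ => //.
  exact/(cong_refl ax)/nesym.
have [kM|nkM] := pselect (k M).
  have [n [pn nN]] := isosceles_perp Lj njN jP jQ cNPQ midM.
  have nMN : M <> N by move=> e; apply: njN; rewrite -e.
  have enk : n = k.
    by apply: line_eq (perp_liner pn) Lk nMN (perp_r pn) nN kM kN.
  rewrite enk in pn; apply: nMN.
  exact: perp_foot_uniq (perp_sym pn) p jP mP (offk _ _ p mP nPN).
have nMZ : M <> Z by move=> e; apply: nkM; rewrite e.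
(* D on j would be the common point of j and k, and the midpoint of PQ. *)
have njk D : k D -> D <> N -> ~ j D.
  move=> kD nDN jD.
  have eDZ : D = Z.
    apply: line_meet kD jD kZ jZ => // ekj; by apply: nkM; rewrite ekj.
  apply: nMZ; symmetry; apply: midpoint_uniq jP jQ jZ midM _ => //.
  by rewrite -eDZ; apply: kPQ.
have [D [nDN kD]] := line_other N Lk.
have [E [bE cE]] := extension nDN (nesym nDN).
have kE := bet_on3 Lk kD kN bE; have [_ nNE nDE] := bet_neq bE.
have [n [pn nD]] := isosceles_perp Lj (njk D kD nDN) jP jQ (kPQ D kD nDN) midM.
have nEN := nesym nNE.
have [n' [pn' nE]] :=
  isosceles_perp Lj (njk E kE nEN) jP jQ (kPQ E kE nEN) midM.
have nMP : M <> P by apply/nesym; case: (bet_neq midM.1).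
have cPDE : cong P D P E.
  apply: (perp_cong (perp_sym p) (perp_sym p)) => //.
    exact/(cong_refl ax)/nesym.
  exact: (cong_sym ax).
have cM : cong M D M E.
  apply: (perp_hypotenuse pn pn' jP nD jP nE _ _ _ cPDE).
  - by move=> e; apply: nkM; rewrite e.
  - by move=> e; apply: nkM; rewrite e.
  exact: (cong_refl ax).
have cZ : cong Z D Z E.
  by apply: (perp_cong pn pn') cM => //; exact: (cong_refl ax).
have midN : midpoint N D E by split=> //; exact: (cong_sym ax).
by apply: njN; rewrite -(midpoint_uniq Lk kD kE kZ midN cZ).
Qed.

(** All points equidistant from U and V lie on the perpendicular erected at the
midpoint of UV. *)
Lemma equidistant_collinear U V A B C : U <> V ->
  cong A U A V -> cong B U B V -> cong C U C V -> A <> B -> collinear A B C.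
Proof.
move=> nUV cA cB cC nAB.
have [k [Lk kU kV]] := line_through nUV; have [N mid] := midpoint_exists ax nUV.
have H X : cong X U X V -> X <> N -> exists m, perp k m N /\ m X.
  move=> cX nXN; apply: (isosceles_perp Lk _ kU kV cX mid) => kX.
  by apply: nXN; apply: midpoint_uniq kU kV kX mid cX.
have [m p] : exists m, perp k m N.
  have [eA|nA] := pselect (A = N); last by have [m []] := H A cA nA; exists m.
  have nBN : B <> N by rewrite -eA; apply/nesym.
  by have [m []] := H B cB nBN; exists m.
have on_m X : cong X U X V -> m X.
  move=> cX; have [->|nX] := pselect (X = N); first exact: perp_r p.
  by have [m' [p' mX]] := H X cX nX; rewrite (perp_erect_uniq p p').
by exists m; split; [exact: perp_liner p| | |]; apply: on_m.
Qed.

(** * Isometries between lines *)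

Record line_iso l l' (f : G -> G) : Prop := LineIso {
  iso_on : forall X, l X -> l' (f X);
  iso_onto : forall Y, l' Y -> exists X, l X /\ f X = Y;
  iso_cong : forall X Y, l X -> l Y -> X <> Y -> cong (f X) (f Y) X Y;
  iso_bet : forall X Y Z, l X -> l Y -> l Z -> bet X Y Z ->
    bet (f X) (f Y) (f Z)
}.

Lemma iso_inj l l' f X Y : line_iso l l' f ->
  l X -> l Y -> X <> Y -> f X <> f Y.
Proof.
by move=> fi lX lY nXY; case: (cong_segment ax (iso_cong fi lX lY nXY)).
Qed.

Lemma iso_bet_inv l l' f X Y Z : line l -> line_iso l l' f ->
  l X -> l Y -> l Z -> X <> Y -> Y <> Z -> X <> Z ->
  bet (f X) (f Y) (f Z) -> bet X Y Z.
Proof.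
move=> Ll fi lX lY lZ nXY nYZ nXZ b.
have [//|b'|b'] := bet_total Ll lX lY lZ nXY nYZ nXZ.
  by case: (bet_excl b (iso_bet fi lY lX lZ b')).
by case: (bet_excl2 b (iso_bet fi lX lZ lY b')).
Qed.

(** ** Points in the same position relative to an origin *)

Implicit Type L : ordered_line G.

(** Equality of coordinates, expressed by order and congruence alone. *)
Definition same_position L O P L' O' P' :=
  [\/ P = O /\ P' = O',
      [/\ olt L O P, olt L' O' P' & cong O P O' P']
    | [/\ olt L P O, olt L' P' O' & cong O P O' P']].

Lemma opposite_order l lt : line_order l lt -> line_order l (fun A B => lt B A).
Proof.
move=> lo; split.
- exact: line_order_irr lo.
- by move=> A B C lA lB lC AB BC; exact: (line_order_trans lo lC lB lA BC AB).
- by move=> A B lA lB nAB; case: (line_order_total lo lA lB nAB); [right|left].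
by move=> A B C lA lB lC; rewrite (line_order_bet lo lA lB lC); tauto.
Qed.

Definition opposite L :=
  OrderedLine (oline_line L) (opposite_order (oline_order L)).

Lemma olt_neq L A B : oline L A -> olt L A B -> A <> B.
Proof.
by move=> LA AB e; rewrite -e in AB; apply: (line_order_irr (oline_order L) LA).
Qed.

Lemma olt_transfer L O A B : oline L O -> A <> B ->
  exists X, [/\ oline L X, olt L O X & cong O X A B].
Proof.
move=> LO nAB; have [lo Ll] := (oline_order L, oline_line L).
have [P [LP OP]] : exists P, oline L P /\ olt L O P.
  have [Q [nQO LQ]] := line_other O Ll.
  have [QO|OQ] := line_order_total lo LQ LO nQO; last by exists Q.
  have [P b] := bet_extend ax nQO; have LP := bet_on3 Ll LQ LO b.
  exists P; split=> //; move: b; rewrite (betE lo) //.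
  by case=> -[// h1 h2]; lt_absurd lo.
have nPO := nesym (olt_neq LO OP).
have [X [LX nXO nb c]] := ray_transfer Ll LO LP nPO nAB.
exists X; split=> //.
by case: (not_bet_lt lo LO LX LP nXO nPO nb) => -[h1 h2] //; lt_absurd lo.
Qed.

Lemma olt_cong_uniq L O X Y : oline L O -> oline L X -> oline L Y ->
  olt L O X -> olt L O Y -> cong O X O Y -> X = Y.
Proof.
move=> LO LX LY OX OY c; apply: (cong_ray_uniq (oline_line L) LO LX LY c).
by apply: (lt_not_bet (oline_order L) LO LX LY); left.
Qed.

Lemma olt_bet L A B C : oline L A -> oline L B -> oline L C ->
  olt L A B -> olt L B C -> bet A B C.
Proof. by move=> LA LB LC AB BC; rewrite (betE (oline_order L)) //; left. Qed.

(** Subtraction of segments when the order of P' and Q' is not given: prolonging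
O'P' by PQ must lead to Q'. *)
Lemma olt_subtract L L' O P Q O' P' Q' :
  oline L O -> oline L P -> oline L Q ->
  oline L' O' -> oline L' P' -> oline L' Q' ->
  olt L O P -> olt L P Q -> olt L' O' P' -> olt L' O' Q' ->
  cong O P O' P' -> cong O Q O' Q' -> olt L' P' Q' /\ cong P Q P' Q'.
Proof.
move=> LO LP LQ LO' LP' LQ' OP PQ OP' OQ' cP cQ.
have [W [LW PW cW]] := olt_transfer LP' (olt_neq LP PQ).
have b := olt_bet LO LP LQ OP PQ; have b' := olt_bet LO' LP' LW OP' PW.
have [add _ _] := cong_addition ax b b'.
have cOW := add cP (cong_sym ax cW).
have OW := line_order_trans (oline_order L') LO' LP' LW OP' PW.
have <- : W = Q'.
  apply: olt_cong_uniq LO' LW LQ' OW OQ' _.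
  exact: (cong_trans ax) (cong_sym ax cOW) cQ.
by split=> //; apply: (cong_sym ax).
Qed.

(** Points on one side of the origin are handled by subtraction, points on
different sides by addition, and the negative half-line by reversing the
orders. *)
Lemma same_position_lt L O L' O' P P' Q Q' :
  oline L O -> oline L P -> oline L Q ->
  oline L' O' -> oline L' P' -> oline L' Q' ->
  same_position L O P L' O' P' -> same_position L O Q L' O' Q' ->
  olt L P Q -> olt L' P' Q' /\ cong P' Q' P Q.
Proof.
move=> LO LP LQ LO' LP' LQ' sP sQ PQ; have lo := oline_order L.
case: sP => [[eP eP']|[OP OP' cP]|[PO PO' cP]]; subst.
- case: sQ => [[eQ eQ']|[OQ OQ' cQ]|[QO QO' cQ]]; subst; try lt_absurd lo.
  by split=> //; apply: (cong_sym ax).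
- have OQ := line_order_trans lo LO LP LQ OP PQ.
  case: sQ => [[eQ eQ']|[_ OQ' cQ]|[QO QO' cQ]]; subst; try lt_absurd lo.
  have [] := olt_subtract LO LP LQ LO' LP' LQ' OP PQ OP' OQ' cP cQ.
  by split=> //; apply: (cong_sym ax).
case: sQ => [[eQ eQ']|[OQ OQ' cQ]|[QO QO' cQ]]; subst.
- by split=> //; apply/(cong_sym ax)/cong_swap2.
- split; first exact: (line_order_trans (oline_order L') LP' LO' LQ' PO' OQ').
  have [add _ _] := cong_addition ax (olt_bet LP LO LQ PO OQ)
    (olt_bet LP' LO' LQ' PO' OQ').
  by apply/(cong_sym ax)/add => //; apply: cong_swap2.
have [] := @olt_subtract (opposite L) (opposite L') O Q P O' Q' P'
  LO LQ LP LO' LQ' LP' QO PQ QO' PO' cQ cP.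
by split=> //; apply/(cong_sym ax)/cong_swap2.
Qed.

Lemma same_position_sym L O P L' O' P' :
  same_position L O P L' O' P' -> same_position L' O' P' L O P.
Proof.
by case=> [[]|[? ? /(cong_sym ax)]|[? ? /(cong_sym ax)]];
  [constructor 1|constructor 2|constructor 3].
Qed.

Lemma same_position_uniq L O L' O' P P' Q' :
  oline L O -> oline L P -> oline L' O' -> oline L' P' -> oline L' Q' ->
  same_position L O P L' O' P' -> same_position L O P L' O' Q' -> P' = Q'.
Proof.
move=> LO LP LO' LP' LQ' sP sQ; apply: contrapT => nPQ.
have [lo lo'] := (oline_order L, oline_order L').
have {sP sQ}[sP sQ] := (same_position_sym sP, same_position_sym sQ).
have [h|h] := line_order_total lo' LP' LQ' nPQ.
  have [h' _] := same_position_lt LO' LP' LQ' LO LP LP sP sQ h.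
  lt_absurd lo.
have [h' _] := same_position_lt LO' LQ' LP' LO LP LP sQ sP h.
lt_absurd lo.
Qed.

Lemma same_position_ex L O P L' O' : oline L O -> oline L P -> oline L' O' ->
  exists P', oline L' P' /\ same_position L O P L' O' P'.
Proof.
move=> LO LP LO'; have [eP|nP] := pselect (P = O).
  by exists O'; split=> //; constructor 1.
have [PO|OP] := line_order_total (oline_order L) LP LO nP.
  have [X [LX XO c]] := @olt_transfer (opposite L') O' O P LO' (nesym nP).
  by exists X; split=> //; constructor 3; split=> //; apply: (cong_sym ax).
have [X [LX XO c]] := olt_transfer LO' (nesym nP).
by exists X; split=> //; constructor 2; split=> //; apply: (cong_sym ax).
Qed.

Lemma position_iso L O L' O' : oline L O -> oline L' O' ->
  exists f, line_iso L L' f /\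
    forall P, oline L P -> same_position L O P L' O' (f P).
Proof.
move=> LO LO'.
have /choice[f fP] P : exists P', oline L P ->
    oline L' P' /\ same_position L O P L' O' P'.
  have [LP|nLP] := pselect (oline L P); last by exists P.
  by have [P' h] := same_position_ex LO LP LO'; exists P'.
have [fon fpos] : (forall P, oline L P -> oline L' (f P)) /\
    (forall P, oline L P -> same_position L O P L' O' (f P)).
  by split=> P /fP[].
have lt X Y : oline L X -> oline L Y -> olt L X Y ->
    olt L' (f X) (f Y) /\ cong (f X) (f Y) X Y.
  move=> LX LY; exact: (same_position_lt LO LX LY LO'
    (fon _ LX) (fon _ LY) (fpos _ LX) (fpos _ LY)).
exists f; split=> //; split=> //.
- move=> Y LY; have [X [LX sX]] := same_position_ex LO' LY LO.
  exists X; split=> //.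
  exact: (same_position_uniq LO LX LO' (fon _ LX) LY
    (fpos _ LX) (same_position_sym sX)).
- move=> X Y LX LY nXY.
  have [h|h] := line_order_total (oline_order L) LX LY nXY.
    by have [] := lt _ _ LX LY h.
  by have [_ /cong_swap2] := lt _ _ LY LX h.
move=> X Y Z LX LY LZ; rewrite (betE (oline_order L)) //.
rewrite (betE (oline_order L')); [|exact: fon..].
by case=> -[h1 h2]; [left|right]; split; apply lt.
Qed.

Lemma ordered_line_lt l A B : line l -> l A -> l B -> A <> B ->
  exists L, oline L = l /\ olt L A B.
Proof.
move=> Ll lA lB nAB; have [lt lo] := line_ordered ax Ll.
have [h|h] := line_order_total lo lA lB nAB.
  by exists (OrderedLine Ll lo).
by exists (OrderedLine Ll (opposite_order lo)).
Qed.

Lemma iso_through l l' A B A' B' : line l -> line l' -> l A -> l B ->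
  l' A' -> l' B' -> cong A' B' A B ->
  exists f, [/\ line_iso l l' f, f A = A' & f B = B'].
Proof.
move=> Ll Ll' lA lB lA' lB' c; have [nAB' nAB] := cong_segment ax c.
have [L [eL AB]] := ordered_line_lt Ll lA lB nAB.
have [L' [eL' AB']] := ordered_line_lt Ll' lA' lB' nAB'.
subst l l'; have [f [fi fpos]] := position_iso lA lA'.
exists f; split=> //.
  apply: (same_position_uniq lA lA lA' (iso_on fi lA) lA' (fpos _ lA)).
  by constructor 1.
apply: (same_position_uniq lA lB lA' (iso_on fi lB) lB' (fpos _ lB)).
by constructor 2; split=> //; apply: (cong_sym ax).
Qed.

(** * Isometries of lines and points off the lines *)

(** Two such points would have their midpoint among the points equidistant from
them, hence on l. *)
Lemma side_uniq l S1 S2 U V A B : line l -> sides l S1 S2 -> S1 U -> S1 V ->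
  l A -> l B -> A <> B -> cong A U A V -> cong B U B V -> U = V.
Proof.
move=> Ll sd sU sV lA lB nAB cA cB; apply: contrapT => nUV.
have [N [b cN]] := midpoint_exists ax nUV.
apply: (sides_same sd sU sV b).
rewrite -(collinearE N Ll nAB lA lB).
exact: equidistant_collinear nUV cA cB cN nAB.
Qed.

(** Reflecting a point A of l in the foot F of the perpendicular from D gives an
isosceles triangle, which Axiom T copies; the foot then goes to the foot, the
altitude keeps its length, and the right triangles at F transfer one by one. *)
Lemma iso_place l l' f D S1 S2 :
  line l -> line l' -> line_iso l l' f -> ~ l D -> sides l' S1 S2 ->
  exists D', S1 D' /\ forall C, l C -> cong (f C) D' C D.
Proof.
move=> Ll Ll' fi nlD sd.
have [m [F [p mD]]] := perp_drop Ll nlD; have lF := perp_l p.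
have nFD : F <> D by move=> e; rewrite e in lF.
have [A [nAF lA]] := line_other F Ll.
have [E [bE cE]] := extension nAF (nesym nAF).
have lE := bet_on3 Ll lA lF bE; have [_ nFE nAE] := bet_neq bE.
have cAE : cong A D E D.
  apply: (perp_cong p p lA mD lE mD); last exact: (cong_refl ax).
  exact: (cong_sym ax).
have ncl : ~ collinear A E D by rewrite (collinearE _ Ll nAE).
have [lA' lE' lF'] := And3 (iso_on fi lA) (iso_on fi lE) (iso_on fi lF).
have [D' [sD cA cE']] :=
  axiom_T ax ncl (iso_cong fi lA lE nAE) Ll' lA' lE' (ex_intro _ S2 sd).
have nlD' := sides_off sd sD.
exists D'; split=> //.
have cAE' : cong D' (f A) D' (f E).
  apply: cong_swap2; apply: (cong_trans ax cA); apply: (cong_trans ax cAE).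
  exact: (cong_sym ax).
have cFE : cong (f F) (f E) (f F) (f A).
  apply: (cong_trans ax (iso_cong fi lF lE nFE)); apply: (cong_trans ax cE).
  by apply/(cong_sym ax)/(iso_cong fi) => //; apply/nesym.
have mid : midpoint (f F) (f A) (f E).
  split; first exact: (iso_bet fi).
  exact: (cong_sym ax cFE).
have [m' [p' mD']] := isosceles_perp Ll' nlD' lA' lE' cAE' mid.
have cF : cong F D (f F) D'.
  apply: (perp_hypotenuse p p' lA mD lA' mD' nFD).
  - by move=> e; rewrite e in lF'.
  - by apply/(cong_sym ax)/(iso_cong fi) => //; exact/nesym.
  exact: (cong_sym ax).
move=> C lC; apply: (cong_sym ax); have [->//|nCF] := pselect (C = F).
apply: (perp_cong p p' lC mD (iso_on fi lC) mD' _ cF).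
by apply/(cong_sym ax)/(iso_cong fi) => //; exact/nesym.
Qed.

(** The copy of D given by [iso_place] has the right distances from A and B, and
only D' does on its side. *)
Lemma iso_cong_off l l' f A B D D' : line l -> line l' -> line_iso l l' f ->
  l A -> l B -> A <> B -> ~ l D -> ~ l' D' ->
  cong (f A) D' A D -> cong (f B) D' B D -> forall C, l C -> cong (f C) D' C D.
Proof.
move=> Ll Ll' fi lA lB nAB nlD nlD' cA cB.
have [S1 [S2 [sd sD]]] := side_of Ll' nlD'.
have [D0 [sD0 c0]] := iso_place Ll Ll' fi nlD sd.
suff -> : D' = D0 by [].
apply: (side_uniq Ll' sd sD sD0 (iso_on fi lA) (iso_on fi lB)
  (iso_inj fi lA lB nAB)).
  by apply: (cong_trans ax cA); apply: (cong_sym ax); auto.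
by apply: (cong_trans ax cB); apply: (cong_sym ax); auto.
Qed.

(** * Extension of an isometry of lines to the plane *)

(** A transversal j of l meets l only at Z, so the side on which a point Y of j
lies is read off from the position of Z relative to P and Y. *)
Lemma iso_sides l l' S1 S2 S1' S2' j j' g P Z Y :
  sides l S1 S2 -> sides l' S1' S2' -> line j -> line j' -> line_iso j j' g ->
  j <> l -> j' <> l' -> line l -> line l' ->
  l Z -> l' (g Z) -> j Z -> j P -> j Y -> ~ l P -> ~ l' (g P) -> Y <> Z ->
  (S1 P -> S1' (g P)) -> (S2 P -> S2' (g P)) -> S1 Y -> S1' (g Y).
Proof.
move=> sd sd' Lj Lj' gi njl njl' Ll Ll' lZ lZ' jZ jP jY nlP nlP' nYZ s1 s2 sY.
have jP' := iso_on gi jP; have jY' := iso_on gi jY; have jZ' := iso_on gi jZ.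
have nlY' : ~ l' (g Y).
  move=> lY'; apply: (iso_inj gi jY jZ nYZ).
  exact: (line_meet Lj' Ll' njl' jY' lY' jZ' lZ').
have nPZ : P <> Z by move=> e; rewrite e in nlP.
have [//|sY'] := sides_cover sd' nlY'.
have [sP|sP] := sides_cover sd nlP.
  have [W [lW bW]] := sides_opposite sd' (s1 sP) sY'.
  have eW : W = g Z.
    exact: (line_meet Lj' Ll' njl' (bet_on2 Lj' jP' jY' bW) lW jZ' lZ').
  have nPY : P <> Y by move=> e; rewrite e in bW; case: (bet_neq bW).
  rewrite eW in bW.
  have b := iso_bet_inv Lj gi jP jZ jY nPZ (nesym nYZ) nPY bW.
  by case: (sides_same sd sP sY b).
have [W [lW bW]] := sides_opposite sd sY sP.
have eW : W = Z by exact: (line_meet Lj Ll njl (bet_on2 Lj jY jP bW) lW jZ lZ).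
rewrite eW in bW; have b := iso_bet gi jY jZ jP bW.
by case: (sides_same (sides_sym sd') sY' (s2 sP) b).
Qed.

Section Extension.
Variables (l l' : set G) (f : G -> G) (S1 S2 S1' S2' : set G).
Hypotheses (Ll : line l) (Ll' : line l') (fi : line_iso l l' f).
Hypotheses (sd : sides l S1 S2) (sd' : sides l' S1' S2').

(** The graph of the extension. Distances from the points of l fix P' only up to
reflection in l', so that the sides have to be recorded as well. *)
Record matched P P' : Prop := Matched {
  matched_on : l P -> P' = f P;
  matched_side1 : S1 P -> S1' P';
  matched_side2 : S2 P -> S2' P';
  matched_cong : forall X, l X -> X <> P -> cong (f X) P' X P
}.

Lemma matched_line P : l P -> matched P (f P).
Proof.
move=> lP; split=> // [sP|sP|X lX nXP].
- by case: (sides_off sd sP).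
- by case: (sides_off (sides_sym sd) sP).
exact: (iso_cong fi).
Qed.

Lemma matched_off P P' : matched P P' -> ~ l P -> ~ l' P'.
Proof.
move=> mt nlP; have [sP|sP] := sides_cover sd nlP.
  exact: (sides_off sd' (matched_side1 mt sP)).
exact: (sides_off (sides_sym sd') (matched_side2 mt sP)).
Qed.

Lemma off_neq X P : l X -> ~ l P -> X <> P.
Proof. by move=> lX nlP e; apply: nlP; rewrite -e. Qed.

Lemma matched_ex P : exists P', matched P P'.
Proof.
have [lP|nlP] := pselect (l P); first by exists (f P); exact: matched_line.
have [sP|sP] := sides_cover sd nlP.
  have [P' [sP' cP]] := iso_place Ll Ll' fi nlP sd'.
  exists P'; split=> // [s2|X lX _]; last exact: cP.
  by case: (sides_disjoint sd sP s2).
have [P' [sP' cP]] := iso_place Ll Ll' fi nlP (sides_sym sd').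
exists P'; split=> // [s1|X lX _]; last exact: cP.
by case: (sides_disjoint sd s1 sP).
Qed.

Lemma two_points : exists A B, [/\ l A, l B & A <> B].
Proof. by have [A [B []]] := line_two_points ax Ll; exists A, B. Qed.

Lemma matched_uniq P P' P'' : matched P P' -> matched P P'' -> P' = P''.
Proof.
move=> m1 m2; have [lP|nlP] := pselect (l P).
  by rewrite (matched_on m1) // (matched_on m2).
have [A [B [lA lB nAB]]] := two_points.
have nfAB := iso_inj fi lA lB nAB.
have c X : l X -> cong (f X) P' (f X) P''.
  move=> lX; have nXP := off_neq lX nlP.
  apply: (cong_trans ax (matched_cong m1 lX nXP)).
  exact/(cong_sym ax)/(matched_cong m2).
have [sP|sP] := sides_cover sd nlP.
  apply: (side_uniq Ll' sd' (matched_side1 m1 sP) (matched_side1 m2 sP)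
    (iso_on fi lA) (iso_on fi lB) nfAB); exact: c.
apply: (side_uniq Ll' (sides_sym sd')
  (matched_side2 m1 sP) (matched_side2 m2 sP)
  (iso_on fi lA) (iso_on fi lB) nfAB); exact: c.
Qed.

Lemma matched_inj P Q P' : matched P P' -> matched Q P' -> P = Q.
Proof.
move=> mP mQ; have [lP|nlP] := pselect (l P); have [lQ|nlQ] := pselect (l Q).
- apply: contrapT => nPQ; apply: (iso_inj fi lP lQ nPQ).
  by rewrite -(matched_on mP lP) -(matched_on mQ lQ).
- by case: (matched_off mQ nlQ); rewrite (matched_on mP lP); exact: (iso_on fi).
- by case: (matched_off mP nlP); rewrite (matched_on mQ lQ); exact: (iso_on fi).
have [A [B [lA lB nAB]]] := two_points.
have c X : l X -> cong X P X Q.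
  move=> lX; apply: (cong_trans ax) (matched_cong mQ lX (off_neq lX nlQ)).
  exact/(cong_sym ax)/(matched_cong mP lX (off_neq lX nlP)).
have [sP|sP] := sides_cover sd nlP; have [sQ|sQ] := sides_cover sd nlQ.
- exact: (side_uniq Ll sd sP sQ lA lB nAB (c _ lA) (c _ lB)).
- by case: (sides_disjoint sd' (matched_side1 mP sP) (matched_side2 mQ sQ)).
- by case: (sides_disjoint sd' (matched_side1 mQ sQ) (matched_side2 mP sP)).
exact: (side_uniq Ll (sides_sym sd) sP sQ lA lB nAB (c _ lA) (c _ lB)).
Qed.

(** For X on l, the distances of X from the points of j follow from those from P
and Z, by [iso_cong_off] with j in the role of the line; so the isometry of j
which is right at P and Z is right everywhere. *)
Lemma matched_transversal j P P' Z : matched P P' -> ~ l P -> l Z ->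
  line j -> j P -> j Z ->
  exists j' g, [/\ line j', line_iso j j' g & forall Y, j Y -> matched Y (g Y)].
Proof.
move=> mP nlP lZ Lj jP jZ; have nZP := off_neq lZ nlP.
have nlP' := matched_off mP nlP.
have cZP := matched_cong mP lZ nZP; have [nZP' _] := cong_segment ax cZP.
have lZ' := iso_on fi lZ.
have [j' [Lj' jZ' jP']] := line_through nZP'.
have [g [gi gZ gP]] := iso_through Lj Lj' jZ jP jZ' jP' cZP.
have njl : j <> l by move=> e; rewrite e in jP.
have njl' : j' <> l' by move=> e; rewrite e in jP'.
exists j', g; split=> // Y jY.
have [->|nYZ] := pselect (Y = Z); first by rewrite gZ; exact: matched_line.
have nlY : ~ l Y by move=> lY; apply: nYZ; apply: line_meet njl _ _ _ _.
have lgZ : l' (g Z) by rewrite gZ.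
have nlgP : ~ l' (g P) by rewrite gP.
split=> //.
- by apply: (iso_sides sd sd' Lj Lj' gi njl njl' Ll Ll'
    lZ lgZ jZ jP jY nlP nlgP nYZ);
    rewrite gP; [exact: (matched_side1 mP) | exact: (matched_side2 mP)].
- by apply: (iso_sides (sides_sym sd) (sides_sym sd') Lj Lj' gi njl njl' Ll Ll'
    lZ lgZ jZ jP jY nlP nlgP nYZ);
    rewrite gP; [exact: (matched_side2 mP) | exact: (matched_side1 mP)].
move=> X lX nXY; have [eX|nXZ] := pselect (X = Z).
  by rewrite eX -gZ; apply: (iso_cong gi) => //; exact/nesym.
have njX : ~ j X by move=> jX; apply: nXZ; apply: line_meet njl _ _ _ _.
have njX' : ~ j' (f X).
  move=> jX'; apply: (iso_inj fi lX lZ nXZ).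
  exact: (line_meet Lj' Ll' njl' jX' (iso_on fi lX) jZ' lZ').
apply: cong_swap2.
apply: (iso_cong_off Lj Lj' gi jP jZ (nesym nZP) njX njX') jY.
  rewrite gP; apply/cong_swap2/(matched_cong mP) => //.
  exact: (off_neq _ nlP).
rewrite gZ; apply: (iso_cong fi) => //; exact/nesym.
Qed.

(** When PQ meets l this is read off on the line PQ. Otherwise Q is prolonged
through a point Z of l to some R; the distances of P from Z and R are preserved,
hence so is that from Q, which lies on the line ZR. *)
Lemma matched_isometry P Q P' Q' : matched P P' -> matched Q Q' -> P <> Q ->
  cong P' Q' P Q.
Proof.
have meet A B A' B' Z j : matched A A' -> matched B B' -> A <> B -> ~ l A ->
    l Z -> line j -> j A -> j B -> j Z -> cong A' B' A B.
  move=> mA mB nAB nlA lZ Lj jA jB jZ.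
  have [j' [g [Lj' gi mg]]] := matched_transversal mA nlA lZ Lj jA jZ.
  rewrite (matched_uniq mA (mg _ jA)).
  rewrite (matched_uniq mB (mg _ jB)).
  exact: (iso_cong gi).
move=> mP mQ nPQ.
have [lP|nlP] := pselect (l P).
  by rewrite (matched_on mP lP); exact: (matched_cong mQ).
have [lQ|nlQ] := pselect (l Q).
  rewrite (matched_on mQ lQ); apply/cong_swap2/(matched_cong mP) => //.
  exact/nesym.
have [k [Lk kP kQ]] := line_through nPQ.
have [[Z [lZ kZ]]|noZ] := pselect (exists Z, l Z /\ k Z).
  exact: meet mP mQ nPQ nlP lZ Lk kP kQ kZ.
have same T1 T2 : sides l T1 T2 -> T1 P -> T1 Q.
  move=> sdT sP; have [//|sQ] := sides_cover sdT nlQ.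
  have [W [lW bW]] := sides_opposite sdT sP sQ.
  by case: noZ; exists W; split=> //; exact: bet_on2 Lk kP kQ bW.
have [Z [_ [lZ _ _]]] := two_points.
have nQZ := nesym (off_neq lZ nlQ).
have [R bR] := bet_extend ax nQZ; have [_ nZR nQR] := bet_neq bR.
have [j [Lj jQ jZ]] := line_through nQZ; have jR := bet_on3 Lj jQ jZ bR.
have njl : j <> l by move=> e; rewrite e in jQ.
have nlR : ~ l R by move=> lR; apply: nZR; apply: line_meet njl _ _ _ _.
have njP : ~ j P.
  by move=> jP; apply: noZ; exists Z; rewrite (line_eq Lk Lj nPQ).
have nPR : P <> R by move=> e; apply: njP; rewrite e.
have cross T1 T2 : sides l T1 T2 -> T1 P -> exists W, l W /\ bet P W R.
  move=> sdT sP; apply: (sides_opposite sdT sP).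
  have [sR|//] := sides_cover sdT nlR.
  by case: (sides_same sdT (same _ _ sdT sP) sR bR).
have [W [lW bW]] : exists W, l W /\ bet P W R.
  have [sP|sP] := sides_cover sd nlP; first exact: cross sd sP.
  exact: cross (sides_sym sd) sP.
have [i [Li iP iR]] := line_through nPR.
have [j' [g [Lj' gi mg]]] := matched_transversal mQ nlQ lZ Lj jQ jZ.
have cPR : cong P' (g R) P R.
  apply: (meet _ _ _ _ _ _ mP (mg _ jR) nPR nlP lW Li iP iR).
  exact: bet_on2 Li iP iR bW.
rewrite (matched_uniq mQ (mg _ jQ)).
(* A point of j' is the image of a point of j, which cannot be P. *)
have njP' : ~ j' P'.
  move=> /(iso_onto gi)[Y [jY eY]]; apply: njP.
  have mY := mg _ jY; rewrite eY in mY.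
  by rewrite (matched_inj mP mY).
apply/cong_swap2.
apply: (iso_cong_off Lj Lj' gi jZ jR nZR njP njP' _ (cong_swap2 cPR)) jQ.
rewrite -(matched_uniq (matched_line lZ) (mg _ jZ)).
by apply: (matched_cong mP) => //; exact: (off_neq _ nlP).
Qed.

End Extension.

(** * Maps preserving congruence *)

Definition preserves_cong (phi : G -> G) :=
  forall X Y, X <> Y -> cong (phi X) (phi Y) X Y.

(** At a point P where phi and psi differed, the points phi A, phi B and phi C
would be equidistant from phi P and psi P, hence collinear. *)
Lemma preserves_cong_eq phi psi A B C : A <> B ->
  preserves_cong phi -> preserves_cong psi ->
  ~ collinear (phi A) (phi B) (phi C) ->
  phi A = psi A -> phi B = psi B -> phi C = psi C -> phi =1 psi.
Proof.
move=> nAB cphi cpsi nc eA eB eC P; apply: contrapT => nP; apply: nc.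
have c X : phi X = psi X -> cong (phi X) (phi P) (phi X) (psi P).
  move=> eX; have nXP : X <> P by move=> e; apply: nP; rewrite -e.
  apply: (cong_trans ax (cphi _ _ nXP)); rewrite eX.
  exact/(cong_sym ax)/cpsi.
apply: (equidistant_collinear nP); [exact: c..|].
by case: (cong_segment ax (cphi _ _ nAB)).
Qed.

(** * Coordinates *)

Section Magnitude.
Variable r : ordered_line G.

Lemma ref_on (X : r) : oline r (val X).
Proof. exact: set_mem (valP X). Qed.

Definition ref_point X (rX : oline r X) : r := exist _ X (mem_set rX).

Lemma ref_inhabited : inhabited r.
Proof.
have [X [_ [_ rX _]]] := line_two_points ax (oline_line r).
by split; exact: ref_point rX.
Qed.

(** The intervals X1 Y1 and X2 Y2 are disjoint, abut or overlap, and addition of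
segments settles each case. *)
Lemma olt_translate L X1 X2 Y1 Y2 :
  oline L X1 -> oline L X2 -> oline L Y1 -> oline L Y2 ->
  olt L X1 Y1 -> olt L X2 Y2 -> cong X1 Y1 X2 Y2 -> olt L X1 X2 ->
  olt L Y1 Y2 /\ cong Y1 Y2 X1 X2.
Proof.
move=> LX1 LX2 LY1 LY2 XY1 XY2 c X12; have lo := oline_order L.
have [e|n] := pselect (Y1 = X2).
  by subst; split=> //; exact: (cong_sym ax).
have [h|h] := line_order_total lo LY1 LX2 n.
  split; first exact: (line_order_trans lo LY1 LX2 LY2 h XY2).
  have [add _ _] := cong_addition ax (olt_bet LX1 LY1 LX2 XY1 h)
    (bet_sym (olt_bet LY1 LX2 LY2 h XY2)).
  apply/(cong_sym ax)/cong_swapr/add; first exact: cong_swapr.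
  exact/(cong_swap ax)/(olt_neq LY1 h).
have [W [LW YW cW]] := olt_transfer LY1 (olt_neq LX1 X12).
have [add _ _] := cong_addition ax (olt_bet LX1 LX2 LY1 X12 h)
  (bet_sym (olt_bet LX2 LY1 LW h YW)).
have cXW : cong X1 Y1 W X2.
  apply: add; first by apply/(cong_sym ax)/cong_swapl.
  exact/(cong_swap ax)/(olt_neq LX2 h).
suff <- : W = Y2 by [].
have XW := line_order_trans lo LX2 LY1 LW h YW.
apply: (olt_cong_uniq LX2 LW LY2 XW XY2).
by apply: (cong_trans ax) c; apply/cong_swapl/(cong_sym ax).
Qed.

(** The translation moves each point of the reference line forward by a segment
congruent to AB; moving backward gives the preimages. *)
Lemma magnitude_ex A B : A <> B -> exists t : translation r, is_magnitude t A B.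
Proof.
move=> nAB.
have /choice[f fP] (X : r) : exists Y : r,
    olt r (val X) (val Y) /\ cong (val X) (val Y) A B.
  have [Y [rY XY c]] := olt_transfer (ref_on X) nAB.
  by exists (ref_point rY).
have mono (X Y : r) : olt r (val X) (val Y) -> olt r (val (f X)) (val (f Y)) /\
    cong (val (f X)) (val (f Y)) (val X) (val Y).
  have [[ltX cX] [ltY cY]] := (fP X, fP Y).
  apply: olt_translate (ref_on _) (ref_on _) (ref_on _) (ref_on _) ltX ltY _.
  exact: (cong_trans ax cX (cong_sym ax cY)).
have tot (X Y : r) : X <> Y -> olt r (val X) (val Y) \/ olt r (val Y) (val X).
  move=> nXY; apply: (line_order_total (oline_order r) (ref_on X) (ref_on Y)).
  by move=> /val_inj.
have f_inj (X Y : r) : f X = f Y -> X = Y.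
  move=> e; apply: contrapT => /tot[] /mono[+ _]; rewrite e;
  exact: (line_order_irr (oline_order r) (ref_on _)).
have /choice[g gK] (Y : r) : exists X : r, f X = Y.
  have [X [rX YX c]] := @olt_transfer (opposite r) (val Y) A B (ref_on Y) nAB.
  exists (ref_point rX); apply: val_inj.
  have [lt cX] := fP (ref_point rX).
  apply: (@olt_cong_uniq r _ _ _ rX (ref_on _) (ref_on Y) lt YX).
  by apply: (cong_trans ax cX); apply: (cong_sym ax); apply: cong_swapl.
have fbij : bijective f by exists g => // X; apply: f_inj; rewrite gK.
have f_cong (X Y : r) : X <> Y -> cong (val (f X)) (val (f Y)) (val X) (val Y).
  by move=> /tot[] /mono[_ //]; exact: cong_swap2.
exists (Translation fbij (fun (X Y : r) h => (mono X Y h).1) f_cong).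
by split=> X; case: (fP X).
Qed.

Lemma magnitude_cong (t : translation r) A B C D :
  is_magnitude t A B -> is_magnitude t C D -> cong A B C D.
Proof.
move=> [_ h1] [_ h2]; have [X] := ref_inhabited.
exact: (cong_trans ax (cong_sym ax (h1 X)) (h2 X)).
Qed.

Lemma cong_magnitude (t : translation r) A B C D :
  is_magnitude t A B -> cong A B C D -> is_magnitude t C D.
Proof. by move=> [pos h] c; split=> // X; apply: (cong_trans ax (h X)). Qed.

Lemma tr_oppK (t : translation r) : cancel t (tr_opp t).
Proof. by rewrite /tr_opp /=; case: (tr_inv t). Qed.

Lemma tr_oppKV (t : translation r) : cancel (tr_opp t) t.
Proof. by rewrite /tr_opp /=; case: (tr_inv t). Qed.

Lemma tr_pos_neq (t : translation r) (X : r) : tr_pos t -> t X <> X.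
Proof. by move=> /(_ X) h e; apply: (olt_neq (ref_on X) h); rewrite e. Qed.

Lemma tr_zero_not_pos : ~ tr_pos (tr_zero r).
Proof. by have [X] := ref_inhabited; move=> /(@tr_pos_neq _ X); apply. Qed.

Lemma tr_opp_not_pos (t : translation r) : tr_pos t -> ~ tr_pos (tr_opp t).
Proof.
move=> p1 p2; have [X] := ref_inhabited; have := p2 (t X); rewrite tr_oppK => h.
exact: (lt_asym (oline_order r) (ref_on _) (ref_on _) (p1 X) h).
Qed.

Lemma tr_opp_zero (t : translation r) : tr_pos t -> tr_zero r <> tr_opp t.
Proof.
move=> pos e; have [X] := ref_inhabited; apply: (tr_pos_neq (X := X) pos).
by rewrite -[RHS](tr_oppK t) -e.
Qed.

Lemma tr_opp_inj (t u : translation r) : tr_opp t = tr_opp u -> t =1 u.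
Proof. by move=> e X; rewrite -[LHS](tr_oppKV u) -e tr_oppK. Qed.

(** Every segment has a magnitude, and a positive translation is neither zero nor
the opposite of a positive one, so that equal coordinates have equal signs. *)
Lemma same_coordinateP L O P L' O' P' :
  same_coordinate r L O P L' O' P' <-> same_position L O P L' O' P'.
Proof.
split=> [[t [c c']]|].
  case: c c' => [[eP ->]|[OP m]|[PO [f [m ->]]]].
  - case=> [[eP' _]|[_ [pos _]]|[_ [g [[pos _] e]]]]; first by constructor 1.
      by case: tr_zero_not_pos.
    by case: (tr_opp_zero pos e).
  - case=> [[_ e]|[OP' m']|[_ [g [[pos _] e]]]].
    + by case: tr_zero_not_pos; rewrite -e; case: m.
    + by constructor 2; split=> //; exact: magnitude_cong m m'.
    + by case: (tr_opp_not_pos pos); rewrite -e; case: m.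
  case=> [[_ e]|[OP' [m' _]]|[PO' [g [m' e]]]].
  - by case: (tr_opp_zero m.1).
  - by case: (tr_opp_not_pos m.1 m').
  constructor 3; split=> //; apply: (magnitude_cong m); case: m' => pos h.
  by split=> [X|X]; rewrite (tr_opp_inj e).
case=> [[-> ->]|[OP OP' c]|[PO PO' c]].
  by exists (tr_zero r); split; constructor 1.
  have [nOP _] := cong_segment ax c; have [t m] := magnitude_ex nOP.
  exists t; split; constructor 2; split=> //; exact: cong_magnitude m c.
have [nOP _] := cong_segment ax c; have [t m] := magnitude_ex nOP.
exists (tr_opp t); split; constructor 3; split=> //; exists t; split=> //.
exact: cong_magnitude m c.
Qed.

End Magnitude.

(** * Systems of axes *)

Lemma axes_perp (a : axes G) : perp (xaxis a) (yaxis a) (origin a).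
Proof.
have [M p] :=
  perpendicular_perp (oline_line _) (oline_line _) (axes_perpendicular a).
by rewrite (perp_meet p (origin_xaxis a) (origin_yaxis a)).
Qed.

(** The coordinate condition on the axes, freed from the reference line. *)
Definition maps_axes (a a' : axes G) (phi : G -> G) :=
  (forall P, oline (xaxis a) P -> oline (xaxis a') (phi P) /\
     same_position (xaxis a) (origin a) P (xaxis a') (origin a') (phi P)) /\
  (forall P, oline (yaxis a) P -> oline (yaxis a') (phi P) /\
     same_position (yaxis a) (origin a) P (yaxis a') (origin a') (phi P)).

Lemma extends_axes_mapP (r : ordered_line G) a a' phi :
  extends_axes_map r a a' phi <-> maps_axes a a' phi.
Proof.
by split=> -[hx hy]; split=> P lP; [have [? h] := hx _ lP|have [? h] := hy _ lP
  |have [? h] := hx _ lP|have [? h] := hy _ lP];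
  split=> //; exact/(same_coordinateP r).
Qed.

Lemma same_position_cong L O P L' O' P' :
  same_position L O P L' O' P' -> P <> O -> cong O P O' P'.
Proof. by case=> [[-> _]|[]|[]]. Qed.

Lemma same_position_refl L O P : oline L O -> oline L P ->
  same_position L O P L O P.
Proof.
move=> LO LP; have [->|nPO] := pselect (P = O); first by constructor 1.
have [h|h] := line_order_total (oline_order L) LP LO nPO;
  [constructor 3|constructor 2]; split=> //; exact/(cong_refl ax)/nesym.
Qed.

Lemma same_position_origin L O L' O' P' :
  oline L O -> oline L' O' -> oline L' P' ->
  same_position L O O L' O' P' -> P' = O'.
Proof.
move=> LO LO' LP' sp; apply: (same_position_uniq LO LO LO' LP' LO' sp).
by constructor 1.
Qed.

Lemma half_line_side L l S1 S2 O Y P : perp l (oline L) O -> sides l S1 S2 ->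
  oline L Y -> olt L O Y -> S1 Y -> oline L P ->
  (olt L O P -> S1 P) /\ (olt L P O -> S2 P).
Proof.
move=> p sd LY OY sY LP; have [LO lO] := (perp_r p, perp_l p).
have lo := oline_order L.
have off : P <> O -> ~ l P.
  by move=> nPO lP; apply: nPO; exact: perp_meet p lP LP.
split=> h.
  have [//|sP] := sides_cover sd (off (nesym (olt_neq LO h))).
  have [Z [lZ b]] := sides_opposite sd sY sP.
  have eZ := perp_meet p lZ (bet_on2 (oline_line L) LY LP b); rewrite eZ in b.
  by case: (lt_not_bet lo LO LY LP (or_introl (conj OY h)) b).
have [sP|//] := sides_cover sd (off (olt_neq LP h)).
by case: (sides_same sd sP sY (olt_bet LP LO LY h OY)).
Qed.

(** The sides of l and l' to be matched are those of the positive halves of the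
y-axes. *)
Lemma maps_axes_ex a a' : exists phi, preserves_cong phi /\ maps_axes a a' phi.
Proof.
have [p p'] := (axes_perp a, axes_perp a').
have [xO xO'] := (origin_xaxis a, origin_xaxis a').
have [yO yO'] := (origin_yaxis a, origin_yaxis a').
rewrite /maps_axes.
move: (xaxis a) (xaxis a') (yaxis a) (yaxis a') (origin a) (origin a')
  p p' xO xO' yO yO' => L L' M M' O O' p p' xO xO' yO yO'.
have [LL LL'] := (oline_line L, oline_line L').
have [f [fi fpos]] := position_iso xO xO'.
have fO : f O = O'.
  exact: same_position_origin xO xO' (iso_on fi xO) (fpos _ xO).
have [Q [nQO _]] := line_other O LL.
have [Y [yY OY _]] := olt_transfer yO nQO.
have [Y' [yY' OY' _]] := olt_transfer yO' nQO.
have off (N K : ordered_line G) X P : perp (oline N) (oline K) X ->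
    oline K P -> P <> X -> ~ oline N P.
  by move=> pN KP nP NP; apply: nP; exact: perp_meet pN NP KP.
have [S1 [S2 [sd sY]]] := side_of LL (off _ _ _ _ p yY (nesym (olt_neq yO OY))).
have [S1' [S2' [sd' sY']]] :=
  side_of LL' (off _ _ _ _ p' yY' (nesym (olt_neq yO' OY'))).
have /choice[phi mphi] := matched_ex LL LL' fi sd sd'.
exists phi; split.
  by move=> A B; apply: (matched_isometry LL LL' fi sd sd').
split=> P lP.
  by rewrite (matched_on (mphi P) lP); split; [exact: (iso_on fi)|exact: fpos].
have [P' [lP' sp]] := same_position_ex yO lP yO'.
suff -> : phi P = P' by [].
apply: (matched_uniq LL LL' fi sd sd' (mphi P)).
have [eP|nPO] := pselect (P = O).
  rewrite eP in sp *; rewrite (same_position_origin yO yO' lP' sp) -fO.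
  exact: (matched_line _ _ fi sd xO).
have nlP := off _ _ _ _ p lP nPO; have c := same_position_cong sp nPO.
have [pos neg] := half_line_side p sd yY OY sY lP.
have [pos' neg'] := half_line_side p' sd' yY' OY' sY' lP'.
split=> //.
- move=> sP; case: sp => [[]|[_ /pos']|[PO _ _]] //.
  by case: (sides_disjoint sd sP (neg PO)).
- move=> sP; case: sp => [[]|[OP _ _]|[_ /neg']] //.
  by case: (sides_disjoint sd (pos OP) sP).
move=> X lX _; apply: (cong_sym ax).
have [->|nXO] := pselect (X = O); first by rewrite fO.
apply: (perp_cong p p' lX lP (iso_on fi lX) lP' _ c).
exact: (same_position_cong (fpos _ lX) nXO).
Qed.

Lemma maps_axes_uniq a a' phi psi :
  preserves_cong phi -> preserves_cong psi ->
  maps_axes a a' phi -> maps_axes a a' psi -> phi = psi.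
Proof.
move=> cphi cpsi [xphi yphi] [xpsi ypsi]; apply/funext.
have [xO xO'] := (origin_xaxis a, origin_xaxis a').
have [yO yO'] := (origin_yaxis a, origin_yaxis a').
have [X [nXO lX]] := line_other (origin a) (oline_line (xaxis a)).
have [Y [nYO mY]] := line_other (origin a) (oline_line (yaxis a)).
have eqx P : oline (xaxis a) P -> phi P = psi P.
  move=> lP; have [l1 s1] := xphi P lP; have [l2 s2] := xpsi P lP.
  exact: (same_position_uniq xO lP xO' l1 l2 s1 s2).
have eqy P : oline (yaxis a) P -> phi P = psi P.
  move=> lP; have [l1 s1] := yphi P lP; have [l2 s2] := ypsi P lP.
  exact: (same_position_uniq yO lP yO' l1 l2 s1 s2).
have [lO' sO'] := xphi _ xO; have eO' := same_position_origin xO xO' lO' sO'.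
apply: (preserves_cong_eq (nesym nXO) cphi cpsi)
  (eqx _ xO) (eqx _ lX) (eqy _ mY).
have [nOX' _] := cong_segment ax (cphi _ _ (nesym nXO)).
have [nOY' _] := cong_segment ax (cphi _ _ (nesym nYO)).
rewrite (collinearE _ (oline_line (xaxis a')) nOX' lO' (xphi _ lX).1) => lY'.
apply: nOY'; rewrite eO'; apply/esym.
exact: (perp_meet (axes_perp a') lY' (yphi _ mY).1).
Qed.

(** The composite fixes both axes pointwise, as the identity does. *)
Lemma maps_axes_cancel a a' phi psi :
  preserves_cong phi -> preserves_cong psi ->
  maps_axes a a' phi -> maps_axes a' a psi -> cancel phi psi.
Proof.
move=> cphi cpsi [xphi yphi] [xpsi ypsi] P.
have [xO xO'] := (origin_xaxis a, origin_xaxis a').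
have [yO yO'] := (origin_yaxis a, origin_yaxis a').
suff e : psi \o phi = id by rewrite -[LHS]/((psi \o phi) P) e.
apply: (@maps_axes_uniq a a).
- move=> A B nAB /=; have [n _] := cong_segment ax (cphi _ _ nAB).
  exact: (cong_trans ax (cpsi _ _ n) (cphi _ _ nAB)).
- by move=> A B nAB; exact: (cong_refl ax).
- split=> Q lQ /=.
    have [l1 s1] := xphi Q lQ; have [l2 s2] := xpsi _ l1.
    rewrite (same_position_uniq xO' l1 xO l2 lQ s2 (same_position_sym s1)).
    by split=> //; exact: same_position_refl.
  have [l1 s1] := yphi Q lQ; have [l2 s2] := ypsi _ l1.
  rewrite (same_position_uniq yO' l1 yO l2 lQ s2 (same_position_sym s1)).
  by split=> //; exact: same_position_refl.
by split=> Q lQ; split=> //; exact: same_position_refl.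
Qed.

End AbsoluteGeometry.

Theorem theorem5 (G : plane) (r : ordered_line G) (a a' : axes G) :
  exists! phi : G -> G, rigid_motion phi /\ extends_axes_map r a a' phi.
Proof.
have [phi [cphi mphi]] := maps_axes_ex a a'.
have [psi [cpsi mpsi]] := maps_axes_ex a' a.
have phi_bij : bijective phi.
  by exists psi; [exact: (maps_axes_cancel cphi cpsi mphi mpsi)
                 |exact: (maps_axes_cancel cpsi cphi mpsi mphi)].
exists phi; split; first by split=> //; apply/extends_axes_mapP.
move=> chi [[_ cchi] /extends_axes_mapP mchi].
exact: (maps_axes_uniq cphi cchi mphi mchi).
Qed.
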